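(* There exist positive odd integers $n_1<n_2<\cdots$, each coprime to $q$, such that for any abelian groups $G_i$ of order $n_i$ ($i=1,2,\dots$) there are Hermitian LCD $2$-quasi-abelian codes $\mathcal{C}_i\subseteq(\mathbb{F}_{q^2}G_i)^2$ forming an asymptotically good sequence; more precisely, there is $\delta>0$ such that each $\mathcal{C}_i$ has length $2n_i\to\infty$, rate $\dim_{\mathbb{F}_{q^2}}\mathcal{C}_i/(2n_i)=1/2$, and relative minimum distance $>\delta$.
   Context: Let $q$ be a prime power and $\mathbb{F}_{q^2}$ the field with $q^2$ elements. For a finite abelian group $G$ of odd order $n$ coprime to $q$, let $\tau:\mathbb{F}_{q^2}G\to\mathbb{F}_{q^2}G$, $\sum_g\alpha_g g\mapsto\sum_g\alpha_g^q g^{-1}$. The Hermitian inner product on $(\mathbb{F}_{q^2}G)^2$ is $\langle(a_1,b_1),(a_2,b_2)\rangle_H=\sum_g a_{1,g}a_{2,g}^q+\sum_g b_{1,g}b_{2,g}^q$. A $2$-quasi-abelian code is an $\mathbb{F}_{q^2}G$-submodule $\mathcal{C}$ of $(\mathbb{F}_{q^2}G)^2$ (viewed as a code of length $2n$ via coefficients); it is Hermitian LCD if $\mathcal{C}\cap\mathcal{C}^{\perp_H}=\{0\}$. The relative minimum distance is $\min_{0\neq c\in\mathcal{C}}\mathrm{wt}_H(c)/(2n)$ with $\mathrm{wt}_H$ the number of nonzero coefficients. A sequence of codes is asymptotically good if lengths tend to infinity and both rates and relative minimum distances are bounded below by positive constants. *)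

(* Defs.v *)
From HB Require Import structures.
From mathcomp Require Import all_boot all_order all_fingroup all_algebra all_field.
Set Implicit Arguments. Unset Strict Implicit. Unset Printing Implicit Defensive.
Import GRing.Theory Num.Theory.
Local Open Scope ring_scope.

Definition galg_mul (F : finFieldType) (gT : finGroupType)
  (a b : {ffun gT -> F^o}) : {ffun gT -> F^o} :=
  [ffun h => \sum_(g : gT) a g * b ((g^-1) * h)%g].

Notation galg2 F gT := ({ffun gT -> F^o} * {ffun gT -> F^o})%type.

Definition is_FG_submodule (F : finFieldType) (gT : finGroupType)
  (C : {vspace galg2 F gT}) : Prop :=
  forall (r : {ffun gT -> F^o}) (c : galg2 F gT),
    c \in C -> ((galg_mul r c.1, galg_mul r c.2) : galg2 F gT) \in C.

Definition herm_ip (F : finFieldType) (gT : finGroupType) (q : nat)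
  (u v : galg2 F gT) : F :=
  \sum_(g : gT) u.1 g * (v.1 g) ^+ q + \sum_(g : gT) u.2 g * (v.2 g) ^+ q.

Definition herm_LCD (F : finFieldType) (gT : finGroupType) (q : nat)
  (C : {vspace galg2 F gT}) : Prop :=
  forall v : galg2 F gT, v \in C ->
    (forall c : galg2 F gT, c \in C -> herm_ip q c v = 0) -> v = 0.

Definition wtH (F : finFieldType) (gT : finGroupType) (c : galg2 F gT) : nat :=
  #|[set g : gT | c.1 g != 0]| + #|[set g : gT | c.2 g != 0]|.

Definition rel_min_dist_gt (F : finFieldType) (gT : finGroupType)
  (C : {vspace galg2 F gT}) (delta : rat) : Prop :=
  forall c : galg2 F gT, c \in C -> c != 0 ->
    delta < (wtH c)%:R / (2 * #|gT|)%:R.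

(* Main.v *)
Require Import Defs.
From HB Require Import structures.
From mathcomp Require Import all_boot all_order all_fingroup all_algebra.
From mathcomp Require Import all_solvable all_field.
From mathcomp Require Import zify ring lra.
Set Implicit Arguments. Unset Strict Implicit. Unset Printing Implicit Defensive.
Import Order.TTheory GRing.Theory Num.Theory.
Local Open Scope ring_scope.

(** The lengths are primes [p] dividing [(q^r - 1)/(q - 1)] with [r] a large
    prime: then [q] has odd order [r] modulo [p], so has [Q = q^2], and
    [p < q^r = sqrt(Q^r)].  The group algebra of a group of order [p] is [F]
    times [s = (p - 1)/r] fields of size [Q^r], and the involution [tau] swaps
    these fields in pairs because [-1] is not a power of [q] modulo [p].

    The code is [C_b = {(a, a b)}] for a random [b] in the augmentation ideal.
    It is Hermitian LCD as soon as [1 + b tau(b)] is invertible, which fails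
    with probability at most [p / Q^r] by the union bound over the components.
    For the distance, group the elements [a] by the set [J] of the components
    where they do not vanish.  An ideal of dimension [d] has an information
    set of size [d], and averaging over the translates of this set shows that
    it contains at most [2 2^(d/16)] words of small relative weight.  If [a] has
    component set [J], then [a b] is uniform among [Q^(r |J|)] values, and
    [sum_J 2^((r - 3) |J|) Q^(- r |J|)] over nonempty [J] is small since
    [s < q^r]. *)

(** * Low weight words in translation invariant spaces *)

Lemma leq_expr2 (m n e : nat) : (m <= n -> m ^ e <= n ^ e)%N.
Proof. by case: e => // e mn; rewrite leq_exp2r. Qed.

Section InformationSet.
Variables (I : finType) (F : finFieldType).
Implicit Type V : {set {ffun I -> F^o}}.

Lemma information_set V : 0 \in V -> {in V &, forall u v, u + v \in V} ->
    (forall c, {in V, forall v, c *: v \in V}) ->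
  exists2 S : {set I},
    {in V, forall v : {ffun I -> F^o}, (forall i, i \in S -> v i = 0) -> v = 0}
    & (#|F| ^ #|S| <= #|V|)%N.
Proof.
move=> V0 VD VZ.
pose P (S : {set I}) := [forall v in V, [forall i in S, v i == 0] ==> (v == 0)].
have PT : P setT.
  apply/forall_inP => v _; apply/implyP => /forall_inP h.
  by apply/eqP/ffunP => i; rewrite ffunE (eqP (h i _)) ?inE.
(* By minimality of [S], each [i] in [S] has a vector of [V] whose restriction
   to [S] is supported at [i]; these span a space of dimension [#|S|]. *)
have [S PS minS] := arg_minnP (fun S : {set I} => #|S|) PT.
exists S.
  move=> v Vv h; apply/eqP.
  have /implyP := forall_inP PS v Vv; apply; apply/forall_inP => i Si.
  by apply/eqP/h.
have ex (i : I) : exists v : {ffun I -> F^o}, (i \in S) ==>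
    [&& v \in V, v i != 0 & [forall j in S, (j != i) ==> (v j == 0)]].
  case Si: (i \in S) => /=; last by exists 0.
  have: ~~ P (S :\ i).
    apply/negP => /minS; rewrite (cardsD1 i S) Si; lia.
  rewrite negb_forall_in => /exists_inP[v Vv]; rewrite negb_imply.
  case/andP=> /forall_inP h nz; exists v; rewrite Vv /=; apply/andP; split.
    apply: contra nz => vi; have /implyP := forall_inP PS v Vv; apply.
    apply/forall_inP => j Sj; have [->//|ji] := eqVneq j i.
    by apply: h; rewrite !inE ji.
  apply/forall_inP => j Sj; apply/implyP => ji; apply: h; rewrite !inE ji //.
pose w i := xchoose (ex i).
have wP i : i \in S -> [/\ w i \in V, w i i != 0
    & forall j, j \in S -> j != i -> w i j = 0].
  move=> Si; have /implyP/(_ Si)/and3P[? ? /forall_inP h] := xchooseP (ex i).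
  split=> // j Sj ji; apply/eqP; exact: (implyP (h j Sj)).
pose comb (c : {ffun I -> F}) : {ffun I -> F^o} := \sum_(i in S) c i *: w i.
have combE c j : j \in S -> comb c j = c j * w j j.
  move=> Sj; rewrite /comb sum_ffunE (bigD1 j) //= ffunE big1 ?addr0 // => i /andP[Si ij].
  by have [_ _ h] := wP i Si; rewrite ffunE h ?scaler0 // eq_sym.
rewrite -(card_pffun_on 0 (mem S) (mem F)) -(card_in_imset (f := comb)).
  apply/subset_leq_card/subsetP => _ /imsetP[c _ ->].
  rewrite /comb; elim/big_ind: _ => // i Si; apply: VZ; by have [] := wP i Si.
move=> c d /pffun_onP[/supportP hc _] /pffun_onP[/supportP hd _] e.
apply/ffunP => i; have [Si|nSi] := boolP (i \in S); last by rewrite hc ?hd.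
have [_ nz _] := wP i Si.
by apply: (mulIf nz); rewrite -!combE // e.
Qed.

End InformationSet.

Definition supp (I : finType) (F : finFieldType) (v : {ffun I -> F}) : {set I} :=
  [set i | v i != 0].

(** The factor 2 pays for the averaging in [low_weight_le]: a word of relative weight at most 1/M
    keeps relative weight at most 2/M on at least half of the translates of [S]. *)
Definition low_words (I : finType) (F : finFieldType) (M : nat) (S : {set I}) :
    {set {ffun I -> F}} :=
  [set v in pffun_on 0 (mem S) (mem F) | (M * #|supp v| <= 2 * #|S|)%N].

(* Chernoff bound: weigh each word [v] by [X ^ (#|S| - #|supp v|)]. *)
Lemma low_words_le (I : finType) (F : finFieldType) (M X : nat) (S : {set I}) :
    (0 < M)%N -> (0 < X)%N ->
  (#|@low_words I F M S| * X ^ #|S| <=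
     X ^ (2 * #|S| %/ M) * (X + #|F|) ^ #|S|)%N.
Proof.
move=> M0 X0; set m := (_ %/ _)%N.
pose wt (c : F) := if c == 0 then X else 1%N.
have sumwt : (\sum_(c in F) wt c <= X + #|F|)%N.
  rewrite (bigD1 0) //= /wt eqxx leq_add2l.
  rewrite (eq_bigr (fun=> 1%N)); last by move=> c /negPf->.
  by rewrite sum1_card; apply/subset_leq_card/subsetP.
have E : (\sum_(f in pffun_on (0%R : F) (mem S) (mem F)) \prod_(i in S) wt (f i)
  <= (X + #|F|) ^ #|S|)%N.
  rewrite -(big_distr_big (0%R : F) (mem S) (mem F) (fun _ c => wt c)) /= prod_nat_const.
  exact: leq_expr2.
apply: (leq_trans _ (leq_mul (leqnn _) E)).
rewrite -sum1_card big_distrl /= big_distrr /=.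
rewrite big_mkcond [leqRHS]big_mkcond /=; apply: leq_sum => v _.
rewrite inE; case: ifP => //= /andP[-> hw].
rewrite mul1n.
have sv : (#|supp v| <= m)%N by rewrite /m leq_divRL // mulnC.
apply: (@leq_trans (X ^ #|supp v| * \prod_(i in S) wt (v i)))%N; last first.
  by rewrite leq_mul2r; apply/orP; right; rewrite leq_pexp2l.
rewrite -prod_nat_const (bigID (mem (supp v))) /= [in leqRHS](bigID (mem (supp v))) /=.
rewrite mulnA; apply: leq_mul.
  rewrite prod_nat_const; apply: (@leq_trans (X ^ #|supp v|)%N).
    by rewrite leq_pexp2l //; apply/subset_leq_card/subsetP => i /andP[].
  rewrite leq_pmulr // prodn_gt0 // => i; rewrite /wt; by case: ifP.
apply: leq_prod => i /andP[_]; rewrite inE negbK /wt => ->; exact: leqnn.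
Qed.

(** The induction step costs a term in x^2, absorbed by the second hypothesis. It serves for (1 +
    1/64)^32 <= 2 and for (1 + y)^s, the sum of y^|J| over all subsets J. *)
Lemma expr1D_le (R : realFieldType) (x : R) (k : nat) :
  0 <= x -> 2 * k%:R * x <= 1 -> (1 + x) ^+ k <= 1 + 2 * k%:R * x.
Proof.
move=> x0; elim: k => [|k IH] h; first by rewrite expr0 mulr0 mul0r addr0.
rewrite -natr1 in h *.
have k0 : 0 <= k%:R :> R by [].
rewrite exprSr; apply: (@le_trans _ _ ((1 + 2 * k%:R * x) * (1 + x))).
  by apply: ler_wpM2r; [nra|apply: IH; nra].
nra.
Qed.

(** With X = 64 |F| both factors of [low_words_le] are under control: (X + |F|)^32 <= 2 X^32, and m
    <= d/(32 X) gives X^m <= 2^(d/32) by X <= 2^X. So the 32nd power of the count is at most 4^d. *)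
Lemma low_words_exp_le (I : finType) (F : finFieldType) (S : {set I}) :
  (#|@low_words I F (64 * (64 * #|F|)) S| ^ 16 <= 2 ^ #|S|)%N.
Proof.
set X := (64 * #|F|)%N; set W := #|_|; set d := #|S|.
have F0 : (0 < #|F|)%N by apply/card_gt0P; exists 0.
have X0 : (0 < X)%N by rewrite muln_gt0.
have := @low_words_le I F (64 * X) X S _ X0; rewrite muln_gt0 X0 -/W -/d.
move=> /(_ isT); set m := (_ %/ _)%N => h.
have h1 : ((X + #|F|) ^ 32 <= 2 * X ^ 32)%N.
  rewrite -(ler_nat rat) natrX natrM natrX natrD.
  have -> : #|F|%:R = X%:R / 64 :> rat by rewrite /X natrM; field.
  have -> : X%:R + X%:R / 64 = X%:R * (1 + 1 / 64) :> rat by field.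
  rewrite exprMn mulrC; apply: ler_wpM2r; first by rewrite exprn_ge0.
  by apply: (le_trans (@expr1D_le _ (1 / 64) 32 _ _)); lra.
have hm : (32 * m * X <= d)%N.
  have : (m * (64 * X) <= 2 * d)%N by apply: leq_trunc_div.
  by move: (m) (X) (d) => m' X' d'; clear; lia.
have h2 : (X ^ (32 * m) <= 2 ^ d)%N.
  apply: (@leq_trans ((2 ^ X) ^ (32 * m))).
    by apply: leq_expr2; rewrite ltnW // ltn_expl.
  by rewrite -expnM leq_exp2l // mulnC.
have h3 : (W ^ 32 * (X ^ 32) ^ d <= 2 ^ d * (2 ^ d * (X ^ 32) ^ d))%N.
  apply: (@leq_trans ((X ^ m * (X + #|F|) ^ d) ^ 32)).
    rewrite -expnM (mulnC 32%N) expnM -expnMn; exact: leq_expr2.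
  rewrite expnMn -expnM (mulnC m) leq_mul //.
  rewrite -expnM mulnC expnM -expnMn; exact: leq_expr2.
have h4 : (W ^ 32 <= 2 ^ d * 2 ^ d)%N.
  by rewrite mulnA leq_pmul2r ?expn_gt0 ?X0 // in h3.
by rewrite -(@leq_exp2r _ _ 2) // -expnM -[in leqRHS]mulnn.
Qed.

Section LowWeight.
Variables (gT : finGroupType) (F : finFieldType).

(* Markov: on average over [g], [v] has [#|S| #|supp v| / #|gT|] nonzero entries
   on the translate of [S] by [g], so at least half of the translates see at
   most twice this number. *)
Lemma low_weight_le (V : {set {ffun gT -> F}}) (S : {set gT}) (M : nat) :
    (forall g, {in V &, injective (fun v : {ffun gT -> F} =>
       [ffun h => if h \in S then v (g * h)%g else 0 : F])}) ->
  (#|[set v in V | (M * #|supp v| <= #|gT|)%N]| <= 2 * #|@low_words gT F M S|)%N.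
Proof.
move=> injV; set low := [set v in V | _]; set W := #|low_words _ _ _|; set d := #|S|.
set n := #|gT|.
have n0 : (0 < n)%N by apply/card_gt0P; exists 1%g.
pose res g (v : {ffun gT -> F}) := [ffun h => if h \in S then v (g * h)%g else 0 : F].
pose good g v := (M * #|supp (res g v)| <= 2 * d)%N.
have total v : (\sum_g #|supp (res g v)| = #|supp v| * d)%N.
  have E g : #|supp (res g v)| = (\sum_(h in S) (v (g * h)%g != 0%R))%N.
    rewrite -sum1_card big_mkcond [RHS]big_mkcond /=; apply: eq_bigr => h _.
    by rewrite inE ffunE; case: (h \in S); rewrite ?eqxx //; case: (_ != _).
  rewrite (eq_bigr _ (fun g _ => E g)) exchange_big /= mulnC -sum_nat_const.
  apply: eq_bigr => h _; rewrite -sum1_card [RHS]big_mkcond /=.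
  rewrite [RHS](reindex_inj (mulIg h)) /=; apply: eq_bigr => g _.
  by rewrite inE; case: (_ != _).
have many v : v \in low -> (n <= 2 * #|[set g | good g v]|)%N.
  rewrite inE => /andP[_ lw].
  have := cardsC [set g | good g v]; rewrite -/n.
  set N := #|[set g | good g v]|; set N' := #|_| => NN'.
  (* Each translate that is not good adds at least 2 d + 1 to M times the total, which is at most n
     d; so fewer than half of them fail. *)
  have : (N' * (2 * d).+1 <= M * \sum_g #|supp (res g v)|)%N.
    rewrite -sum_nat_const big_distrr /= big_mkcond /=; apply: leq_sum => g _.
    by rewrite !inE /good -ltnNge; case: ifP.
  rewrite total mulnA.
  have : (M * #|supp v| * d <= n * d)%N by rewrite leq_mul2r lw orbT.
  nia.
have few g : (#|[set v in low | good g v]| <= W)%N.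
  rewrite -(card_in_imset (f := res g)); last first.
    move=> u v; rewrite !inE => /andP[/andP[Vu _] _] /andP[/andP[Vv _] _].
    exact: injV.
  apply/subset_leq_card/subsetP => _ /imsetP[v vP ->].
  move: vP; rewrite inE => /andP[_ gv]; rewrite in_set; apply/andP; split=> //.
  apply/pffun_onP; split => [|c _ //].
  by apply/supportP => h /negPf hS; rewrite ffunE hS.
have : (#|low| * n <= 2 * (\sum_(v in low) #|[set g | good g v]|))%N.
  rewrite big_distrr /= -sum_nat_const; apply: leq_sum => v; exact: many.
have -> : (\sum_(v in low) #|[set g | good g v]| =
           \sum_g #|[set v in low | good g v]|)%N.
  under eq_bigr => v _ do rewrite -sum1_card big_mkcond.
  rewrite exchange_big /=; apply: eq_bigr => g _.
  rewrite -sum1_card [RHS]big_mkcond [LHS]big_mkcond /=.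
  by apply: eq_bigr => v _; rewrite [in RHS]inE !inE; case: (_ && _).
move=> h; have : (\sum_g #|[set v in low | good g v]| <= n * W)%N.
  by rewrite -sum_nat_const; apply: leq_sum => g _; exact: few.
move: h; set A := (\sum_g _)%N => h1 h2.
rewrite -(leq_pmul2r n0); lia.
Qed.

End LowWeight.

(** * The lengths, and the characters of a group of prime order *)

(** Let p divide c = (q^r - 1)/(q - 1) with r > q prime. If q = 1 modulo p, then c = r modulo p, so
    p = r divides q - 1, impossible. Hence q has order r, and Fermat gives r | p - 1. The sigma
    types allow p to be used as a function of N. *)
Lemma prime_of_large_order (q N : nat) : (1 < q)%N ->
  {p : nat & {r : nat | [/\ prime p, prime r, (N < r)%N, (r < p < q ^ r)%N &
    (forall e, q ^ e = 1 %[mod p] <-> r %| e)%N]}}.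
Proof.
move=> q1; have [r rN pr_r] := prime_above (maxn N q).
have {rN} [Nr qr] : (N < r)%N /\ (q < r)%N by lia.
have r1 := prime_gt1 pr_r.
pose c := (\sum_(i < r) q ^ i)%N.
have cE : (q.-1 * c = q ^ r - 1)%N by rewrite -predn_exp subn1.
have c1 : (1 < c)%N.
  rewrite /c -(prednK (prime_gt0 pr_r)) big_ord_recl expn0 add1n ltnS lt0n.
  rewrite sum_nat_eq0 negb_forall; apply/existsP.
  have r0 : (0 < r.-1)%N by lia.
  by exists (Ordinal r0); rewrite /= -lt0n expn_gt0; lia.
pose p := pdiv c; have pr_p : prime p by apply: pdiv_prime.
have pc : (p %| c)%N by apply: pdiv_dvd.
have qr0 : (0 < q ^ r)%N by rewrite expn_gt0; lia.
have pq : (q ^ r = 1 %[mod p])%N.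
  by apply/eqP; rewrite eqn_mod_dvd // -cE dvdn_mull.
have plt : (p < q ^ r)%N.
  have : (p <= c)%N by apply: dvdn_leq => //; lia.
  have : (1 <= q.-1)%N by lia.
  by move: cE qr0; set B := (q ^ r)%N; nia.
have qn1 : (q <> 1 %[mod p])%N.
  move=> q1p; have : (c = r %[mod p])%N.
    rewrite /c -modn_summ (eq_bigr (fun=> 1 %% p))%N; last first.
      by move=> i _; rewrite -modnXm q1p modnXm exp1n.
    by rewrite modn_summ sum1_card card_ord.
  rewrite (eqP pc) => /esym/eqP => pr.
  have := prime_nt_dvdP pr_r _ pr; move: (prime_gt1 pr_p).
  have [->//|] := eqVneq p 1%N; move=> _ _ /(_ isT) pE.
  move/eqP: q1p; rewrite eqn_mod_dvd; last lia.
  by move/dvdn_leq; rewrite pE; lia.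
have p0 := prime_gt0 pr_p.
have ordq e : (q ^ e = 1 %[mod p] <-> r %| e)%N.
  split=> [qe|/dvdnP[k ->]]; last first.
    by rewrite mulnC expnM -modnXm pq modnXm exp1n.
  apply/negPn/negP => nre; apply: qn1.
  have e0 : (0 < e)%N by case: e nre {qe} => //; rewrite dvdn0.
  have co : coprime e r by rewrite coprime_sym prime_coprime.
  have [u /= v Euv _] := egcdnP r e0.
  rewrite (eqP co) in Euv.
  have : (q ^ (u * e) = 1 %[mod p])%N.
    by rewrite mulnC expnM -modnXm qe modnXm exp1n.
  rewrite Euv expnD expn1 mulnC => <-.
  by rewrite -modnMmr (mulnC v) expnM -(modnXm v) pq modnXm exp1n modnMmr muln1.
exists p, r; split; rewrite ?plt ?andbT //.
have copq : coprime q p.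
  have : coprime (q ^ r) p by rewrite -coprime_modl pq coprime_modl coprime1n.
  by rewrite coprime_pexpl // prime_gt0.
have /ordq : (q ^ p.-1 = 1 %[mod p])%N.
  by rewrite -(Euler_exp_totient copq) totient_prime.
by move/dvdn_leq; have := prime_gt1 pr_p; lia.
Qed.

Section OrbitRepresentatives.
Variables (p r Q : nat).
Hypotheses (pr_p : prime p) (ordQ : forall e, (Q ^ e = 1 %[mod p] <-> r %| e)%N).

(** Multiplication by Q permutes the nonzero residues modulo p, and every orbit has length r because
    Q^e x = x forces Q^e = 1. The [t k], one per orbit, index the nontrivial components of the group
    algebra. *)
Lemma orbit_representatives : (0 < r)%N ->
  exists s (t : 'I_s -> nat), (s * r = p.-1)%N /\
    forall m, ~~ (p %| m)%N -> exists k e, (m = t k * Q ^ e %[mod p])%N.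
Proof.
move=> r0.
pose f (x : 'F_p) : 'F_p := Q%:R * x.
have FpE (m n : nat) : (m%:R == n%:R :> 'F_p) = (m == n %[mod p])%N.
  by rewrite -val_eqE /= !val_Fp_nat.
have Qr : (Q%:R ^+ r = 1 :> 'F_p).
  by apply/eqP; rewrite -natrX (FpE _ 1%N); apply/eqP/ordQ.
have Q0 : Q%:R != 0 :> 'F_p.
  apply/eqP => Q0; move: Qr; rewrite Q0 expr0n (gtn_eqF r0).
  by move/esym/eqP; rewrite oner_eq0.
have injf : injective f by move=> x y; apply: mulfI.
have iterE e x : iter e f x = Q%:R ^+ e * x.
  by elim: e => [|e IH]; rewrite ?expr0 ?mul1r //= IH /f mulrA -exprS.
have ordf (x : 'F_p) : x != 0 -> fingraph.order f x = r.
  move=> x0; have d0 := fingraph.order_gt0 f x.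
  have rd : (r %| fingraph.order f x)%N.
    apply/ordQ/eqP; rewrite -FpE natrX; apply/eqP/(mulIf x0).
    by rewrite -iterE iter_order // mul1r.
  apply/eqP; rewrite eqn_leq (dvdn_leq d0 rd) andbT leqNgt; apply/negP => lt.
  have := findex_iter lt; rewrite iterE Qr mul1r findex0; lia.
pose a := [pred x : 'F_p | x != 0].
have cla : fclosed f a.
  by move=> x y /eqP <-; rewrite !inE /f mulf_eq0 negb_or Q0.
have := fcard_order_set injf (n := r) (a := a).
have -> : #|a| = p.-1.
  by transitivity #|'F_p|.-1; [exact: cardC1 | rewrite card_Fp].
move=> /(_ _ cla) cardE.
pose T := [pred x | froots f x & a x].
exists #|T|, (fun k => nat_of_ord (enum_val k)); split.
  by apply: cardE; apply/subsetP => x ax; rewrite inE ordf.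
move=> m pm; set x : 'F_p := m%:R.
have ax : x != 0.
  by rewrite (FpE m 0%N) mod0n.
have symf : connect_sym (frel f) by apply: fconnect_sym.
have Tx : froot f x \in T.
  rewrite inE /= roots_root //=.
  by have := closed_connect cla (connect_root (frel f) x); rewrite !inE ax => <-.
exists (enum_rank_in Tx (froot f x)), (findex f (froot f x) x).
apply/eqP; rewrite -FpE natrM natrX mulrC enum_rankK_in //.
rewrite natr_Zp -iterE iter_findex // symf; exact: connect_root.
Qed.

End OrbitRepresentatives.

(** X^p - 1 is separable because p is nonzero in F, so its splitting field contains p distinct p-th
    roots of unity. *)
Lemma prim_root_extension (F : finFieldType) (p : nat) :
    prime p -> p%:R != 0 :> F ->
  exists (L : finFieldType) (f : {rmorphism F -> L}) (z : L), p.-primitive_root z.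
Proof.
move=> pr_p pF; have p1 := prime_gt1 pr_p; have p0 := prime_gt0 pr_p.
have nz : 'X^p - 1 != 0 :> {poly F} by rewrite -size_poly_eq0 size_XnsubC.
have [L [rs e _]] := FinSplittingFieldFor nz.
pose K : finFieldType := finvect_type L.
pose iota : {rmorphism F -> K} := GRing.in_alg L.
exists K, iota.
have pK : p%:R != 0 :> K by rewrite -(rmorph_nat iota) fmorph_eq0.
have e' : ('X^p - 1 : {poly K}) %= \prod_(x <- rs) ('X - x%:P).
  by move: e; rewrite rmorphB /= map_polyXn rmorph1.
have szrs : (p <= size rs)%N.
  have := eqp_size e'; rewrite size_prod_XsubC size_XnsubC // => -[<-].
  exact: leqnn.
have urs : uniq rs.
  by rewrite -separable_prod_XsubC -(eqp_separable e') separable_Xn_sub_1.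
have rrs : all p.-unity_root rs.
  by apply/allP => x xrs; have := eqp_root e' x; rewrite root_prod_XsubC xrs.
by have /hasP[z _ zP] := has_prim_root p0 rrs urs szrs; exists z.
Qed.

Lemma faithful_character (gT : finGroupType) (L : fieldType) (z : L) :
    prime #|gT| -> #|gT|.-primitive_root z ->
  exists chi : gT -> L, [/\ chi 1%g = 1, {morph chi : g h / (g * h)%g >-> g * h}
    & forall g, chi g = 1 -> g = 1%g].
Proof.
move=> pr_n zn; have cG : cyclic [set: gT] by rewrite prime_cyclic ?cardsT.
have [x /setP Gx] := cyclicP cG.
have ox : #[x]%g = #|gT| by rewrite /order -cardsT; apply: eq_card => y; rewrite -Gx.
have ex g : exists i, g == (x ^+ i)%g.
  have /cycleP[i ->] : g \in <[x]>%g by rewrite -Gx inE.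
  by exists i.
pose dlog g := xchoose (ex g).
have dlogK g : g = (x ^+ dlog g)%g by apply/eqP; exact: xchooseP (ex g).
exists (fun g => z ^+ dlog g); split=> [|g h|g].
- by apply/eqP; rewrite -(prim_order_dvd zn) -ox order_dvdn -dlogK.
- rewrite -exprD; apply/eqP; rewrite (eq_prim_root_expr zn) -ox -eq_expg_mod_order.
  by rewrite -dlogK expgD -!dlogK.
- by move/eqP; rewrite -(prim_order_dvd zn) -ox order_dvdn -dlogK => /eqP.
Qed.

(** * The Fourier transform on the group algebra *)

Section FourierTransform.
Variables (F L : finFieldType) (iota : {rmorphism F -> L}).
Variables (gT : finGroupType) (chi : gT -> L).
Hypotheses (chiM : {morph chi : g h / (g * h)%g >-> g * h})
  (chi_eq1 : forall g, chi g = 1 -> g = 1%g) (nL : #|gT|%:R != 0 :> L)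
  (chi1 : chi 1%g = 1).
Local Notation FG := {ffun gT -> F^o}.
Implicit Types (a b : FG) (m : nat).

(** The Fourier coefficient at the character chi^m. Indices are natural numbers so that they can be
    multiplied by powers of q; by [ft_mod] only residues matter. *)
Definition ft a m : L := \sum_h iota (a h) * chi h ^+ m.

(** This is the involution tau of the group algebra. *)
Definition herm_inv (q : nat) a : FG := [ffun h => a (h^-1)%g ^+ q].

Lemma chiX g m : chi (g ^+ m)%g = chi g ^+ m.
Proof. by elim: m => [|m IH]; rewrite ?expg0 ?chi1 // expgS chiM IH exprS. Qed.

Lemma chi_order g : chi g ^+ #|gT| = 1.
Proof. by rewrite -chiX -cardsT expg_cardG ?inE // chi1. Qed.

Lemma chi_neq0 g : chi g != 0.
Proof.
apply/eqP => g0; have := chiM g g^-1%g; rewrite mulgV chi1 g0 mul0r => /eqP.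
by rewrite oner_eq0.
Qed.

Lemma chiV g : chi g^-1%g = (chi g)^-1.
Proof.
by apply: (mulfI (chi_neq0 g)); rewrite -chiM mulgV chi1 mulfV // chi_neq0.
Qed.

Lemma chi_mod g m m' : (m = m' %[mod #|gT|])%N -> chi g ^+ m = chi g ^+ m'.
Proof. by move=> e; rewrite -(expr_mod m (chi_order g)) e expr_mod // chi_order. Qed.

Lemma ft_mod a m m' : (m = m' %[mod #|gT|])%N -> ft a m = ft a m'.
Proof. by move=> e; apply: eq_bigr => h _; rewrite (chi_mod h e). Qed.

Lemma ftD a b m : ft (a + b) m = ft a m + ft b m.
Proof.
by rewrite /ft -big_split; apply: eq_bigr => h _; rewrite ffunE rmorphD mulrDl.
Qed.

Lemma ftZ c a m : ft (c *: a) m = iota c * ft a m.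
Proof.
by rewrite /ft big_distrr; apply: eq_bigr => h _; rewrite ffunE rmorphM /= mulrA.
Qed.

Lemma ft0 m : ft 0 m = 0.
Proof. by rewrite /ft big1 // => h _; rewrite ffunE rmorph0 mul0r. Qed.

Lemma ft_at0 a : ft a 0 = iota (\sum_h a h).
Proof. by rewrite /ft rmorph_sum; apply: eq_bigr => h _; rewrite expr0 mulr1. Qed.

Lemma ft_galg_mul a b m : ft (galg_mul a b) m = ft a m * ft b m.
Proof.
rewrite /ft; under eq_bigr => h _ do rewrite ffunE rmorph_sum big_distrl.
rewrite exchange_big big_distrl; apply: eq_bigr => g _ /=.
rewrite (reindex_inj (mulgI g)) big_distrr; apply: eq_bigr => h _ /=.
by rewrite rmorphM /= mulKg chiM exprMn mulrACA.
Qed.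

Lemma ft_translate a g m : ft [ffun h => a (g * h)%g] m = chi g ^- m * ft a m.
Proof.
rewrite /ft [in RHS](reindex_inj (mulgI g)) big_distrr; apply: eq_bigr => h _.
rewrite ffunE chiM exprMn [RHS]mulrCA; congr (_ * _).
by rewrite mulKf // expf_neq0 // chi_neq0.
Qed.

Lemma chi_sum g : \sum_(m < #|gT|) chi g ^+ m = if g == 1%g then #|gT|%:R else 0.
Proof.
have [->|g1] := eqVneq.
  by under eq_bigr => m _ do rewrite chi1 expr1n; rewrite sumr_const card_ord.
have /eqP := subrX1 (chi g) #|gT|; rewrite chi_order subrr eq_sym mulf_eq0.
case/orP=> [|/eqP //]; rewrite subr_eq0 => /eqP/chi_eq1 e.
by rewrite e eqxx in g1.
Qed.

Lemma ft_inversion a g :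
  \sum_(m < #|gT|) ft a m * chi g ^- m = #|gT|%:R * iota (a g).
Proof.
under eq_bigr => m _ do rewrite /ft big_distrl /=.
rewrite exchange_big /= (bigD1 g) //= [X in _ + X]big1 ?addr0; last first.
  move=> h hg; under eq_bigr => m _ do
    rewrite -mulrA -exprVn -chiV -exprMn -chiM.
  by rewrite -big_distrr /= chi_sum -eq_mulgV1 (negPf hg) mulr0.
under eq_bigr => m _ do rewrite mulfK ?expf_neq0 ?chi_neq0 //.
by rewrite sumr_const card_ord mulr_natl.
Qed.

Lemma ft_inj a b : (forall m, ft a m = ft b m) -> a = b.
Proof.
move=> e; apply/ffunP => g; apply: (fmorph_inj iota); apply: (mulfI nL).
by rewrite -!ft_inversion; apply: eq_bigr => m _; rewrite e.
Qed.

(** Only the term m = 0 survives in [ft_inversion], and it does not depend on the group element. *)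
Lemma ft_supp_at0 a : (forall m, ~~ (#|gT| %| m)%N -> ft a m = 0) ->
  forall g h, a g = a h.
Proof.
move=> a0 g h; apply: (fmorph_inj iota); apply: (mulfI nL).
rewrite -!ft_inversion; apply: eq_bigr => m _.
have [m0|m0] := eqVneq (m : nat) 0%N; first by rewrite m0 !expr0.
rewrite a0 ?mul0r // gtnNdvd // lt0n //.
Qed.

Section Frobenius.
Variable q : nat.
Hypotheses (pcharq : [pchar L].-nat q) (cardF : #|F| = (q ^ 2)%N).

Lemma sumrX_pchar (I : finType) (x : I -> L) :
  (\sum_i x i) ^+ q = \sum_i x i ^+ q.
Proof.
elim/big_ind2: _ => // [|u u' v v' <- <-]; last exact: exprDn_pchar.
by rewrite expr0n; case: q pcharq.
Qed.

(** The power map x^(q^2) is additive on L and fixes the image of F. Thus coefficients in one orbit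
    of q^2 determine each other. *)
Lemma ft_frobenius a m e : ft a (m * (q ^ 2) ^ e) = ft a m ^+ ((q ^ 2) ^ e).
Proof.
elim: e => [|e IH]; first by rewrite muln1 expr1.
rewrite expnSr mulnA exprM -IH (exprM _ q q) /ft !sumrX_pchar.
apply: eq_bigr => h _.
by rewrite -exprM mulnn -cardF exprMn -rmorphXn expf_card -exprM; congr (_ * _).
Qed.

(** The hypothesis says that m' = - m / q modulo the group order; this is how tau moves the
    components. *)
Lemma ft_herm_inv a m m' : (#|gT| %| q * m' + m)%N ->
  ft (herm_inv q a) m = ft a m' ^+ q.
Proof.
move=> e; rewrite /ft sumrX_pchar (reindex_inj invg_inj); apply: eq_bigr => h _ /=.
rewrite ffunE invgK rmorphXn exprMn -exprM chiV exprVn; congr (_ * _).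
apply: (mulIf (expf_neq0 m (chi_neq0 h))); rewrite mulVf ?expf_neq0 ?chi_neq0 //.
rewrite -exprD mulnC; have /eqP := e; rewrite -[RHS](mod0n #|gT|) => {}e.
by rewrite (chi_mod h e).
Qed.

Lemma herm_inv_eq0 a : herm_inv q a = 0 -> a = 0.
Proof.
move=> /ffunP e; apply/ffunP => h; have /eqP := e h^-1%g.
by rewrite !ffunE invgK expf_eq0 => /andP[_ /eqP].
Qed.

End Frobenius.
End FourierTransform.

(** * The codes generated by (1, b) *)

Section MultiplierCode.
Variables (F : finFieldType) (gT : finGroupType).
Local Notation FG := {ffun gT -> F^o}.
Implicit Types (a b c : FG).

Lemma galg_mulA a b c : galg_mul a (galg_mul b c) = galg_mul (galg_mul a b) c.
Proof.
apply/ffunP => h; rewrite !ffunE.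
under eq_bigr => g _ do rewrite ffunE big_distrr /=.
under [RHS]eq_bigr => g _ do rewrite ffunE big_distrl /=.
rewrite [RHS]exchange_big /=; apply: eq_bigr => g _.
rewrite [RHS](reindex_inj (mulgI g)) /=; apply: eq_bigr => k _.
by rewrite mulKg invMg !mulgA mulrA.
Qed.

Definition graph b a : galg2 F gT := (a, galg_mul a b).

Fact graph_is_linear b : linear (graph b).
Proof.
move=> c u v; congr (_, _); apply/ffunP => h; rewrite !ffunE.
rewrite scaler_sumr -big_split; apply: eq_bigr => g _ /=.
by rewrite !ffunE mulrDl -scalerAl.
Qed.

HB.instance Definition _ b :=
  GRing.isLinear.Build F FG (galg2 F gT) _ (graph b) (graph_is_linear b).

Definition multiplier_code b : {vspace galg2 F gT} := limg (linfun (graph b)).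

Lemma multiplier_codeP b v :
  reflect (exists a, v = graph b a) (v \in multiplier_code b).
Proof.
apply: (iffP memv_imgP) => [[a _ ->]|[a ->]]; exists a; rewrite ?lfunE ?memvf //.
Qed.

Lemma multiplier_code_submodule b : is_FG_submodule (multiplier_code b).
Proof.
move=> r _ /multiplier_codeP[a ->]; apply/multiplier_codeP.
by exists (galg_mul r a); rewrite /graph /= galg_mulA.
Qed.

Lemma dim_multiplier_code b : \dim (multiplier_code b) = #|gT|.
Proof.
have -> : \dim (multiplier_code b) = \dim {: FG}.
  apply: limg_dim_eq; apply/eqP; rewrite -subv0; apply/subvP => a.
  rewrite memv_cap memv_ker lfunE memv0 => /andP[_ /eqP[->]] //.
have F1 : (1 < #|F|)%N by apply: finNzRing_gt1.
have := card_vspacef (Vector.class FG); rewrite card_vspace card_ffun.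
by move/eqP; rewrite eqn_exp2l // => /eqP.
Qed.

Definition unit_vector (g : gT) : FG := [ffun h => (h == g)%:R].

Lemma galg_mul_unit_vector g b h : galg_mul (unit_vector g) b h = b (g^-1 * h)%g.
Proof.
rewrite ffunE (bigD1 g) //= big1 => [|k /negPf kg]; rewrite ffunE ?kg ?mul0r //.
by rewrite eqxx mul1r addr0.
Qed.

(** The inner product of the translate of (1, b) by g^-1 with (a, a b) is the coefficient at g of
    tau(a) + b tau(a b), which will factor as tau(a) (1 + b tau(b)). *)
Lemma herm_orthogonal_multiplier_code (q : nat) a b :
    (forall c : galg2 F gT, c \in multiplier_code b -> herm_ip q c (graph b a) = 0) ->
  herm_inv q a + galg_mul b (herm_inv q (galg_mul a b)) = 0.
Proof.
move=> orth; apply/ffunP => g.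
have := orth (graph b (unit_vector g^-1)) _.
move=> /(_ (introT (multiplier_codeP _ _) (ex_intro _ _ erefl))).
rewrite /herm_ip /= => e; rewrite ffunE [RHS]ffunE -[RHS]e; congr (_ + _).
  rewrite ffunE (bigD1 g^-1%g) //= big1 => [|k /negPf kg].
    by rewrite ffunE eqxx mul1r addr0.
  by rewrite ffunE kg mul0r.
rewrite ffunE [RHS](reindex_inj (mulgI g^-1%g)) /=; apply: eq_bigr => k _.
by rewrite galg_mul_unit_vector invgK mulKVg [herm_inv _ _ _]ffunE invMg invgK.
Qed.

End MultiplierCode.

(** * The counting argument *)

Lemma card_bigcup_le (I T : finType) (P : pred I) (B : I -> {set T}) :
  (#|\bigcup_(i | P i) B i| <= \sum_(i | P i) #|B i|)%N.
Proof.
elim/big_ind2: _ => [|U m V n hU hV|//]; first by rewrite cards0.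
by apply: leq_trans (leq_add hU hV); rewrite cardsU leq_subr.
Qed.

Section RandomCode.
Variables (F L : finFieldType) (iota : {rmorphism F -> L}).
Variables (gT : finGroupType) (chi : gT -> L).
Hypotheses (chiM : {morph chi : g h / (g * h)%g >-> g * h})
  (chi_eq1 : forall g, chi g = 1 -> g = 1%g) (nL : #|gT|%:R != 0 :> L)
  (chi1 : chi 1%g = 1).
Variables (q r s : nat) (t : 'I_s -> nat).
Local Notation FG := {ffun gT -> F^o}.
Local Notation p := #|gT|.
Local Notation ft := (@ft F L iota gT chi).
Hypotheses (pcharq : [pchar L].-nat q) (cardF : #|F| = (q ^ 2)%N) (q_gt1 : (1 < q)%N)
  (pr_p : prime p) (p_gt2 : (2 < p)%N) (p_lt : (p < q ^ r)%N)
  (r_gt5 : (5 < r)%N) (r_odd : odd r)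
  (ordq : forall e, (q ^ e = 1 %[mod p] <-> r %| e)%N)
  (sr : (s * r = p.-1)%N)
  (tP : forall m, ~~ (p %| m)%N -> exists k e, (m = t k * (q ^ 2) ^ e %[mod p])%N).
Implicit Types (a b : FG) (J : {set 'I_s}).

Let K := ((q ^ 2) ^ r)%N.

Let r_gt0 : (0 < r)%N. Proof. lia. Qed.

Let K_gt0 : (0 < K)%N. Proof. by rewrite !expn_gt0; lia. Qed.

Let q2X_mod e : ((q ^ 2) ^ (r * e) = 1 %[mod p])%N.
Proof. by rewrite -expnM; apply/ordq; rewrite mulnCA dvdn_mulr. Qed.

Lemma ft_fixed a m : ft a m ^+ K = ft a m.
Proof.
rewrite -(ft_frobenius iota chi pcharq cardF); apply: (ft_mod iota chiM chi1).
by rewrite -modnMmr -(muln1 r) q2X_mod modnMmr muln1.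
Qed.

(** Each [ft b (t k)] is a root of X^K - X, so it takes at most K values. With the lower bound on
    |A|, this replaces the statement that the components of a random b are uniform. *)
Lemma card_determined (B : {set FG}) J :
  {in B &, forall b b', (forall k, k \in J -> ft b (t k) = ft b' (t k)) -> b = b'} ->
  (#|B| <= K ^ #|J|)%N.
Proof.
move=> det; pose KL := [set x : L | x ^+ K == x].
have K1 : (1 < K)%N by rewrite -(exp1n r) /K ltn_exp2r // -(exp1n 2) ltn_exp2r.
have cardKL : (#|KL| <= K)%N.
  have sz : size ('X^K - 'X : {poly L}) = K.+1.
    by rewrite size_polyDl size_polyXn // size_polyN size_polyX.
  rewrite -ltnS -sz cardE; apply: max_poly_roots; rewrite ?enum_uniq //.
    by rewrite -size_poly_eq0 sz.
  by apply/allP => x; rewrite mem_enum inE rootE !hornerE subr_eq0.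
pose f b := [ffun k => if k \in J then ft b (t k) else 0].
rewrite -(card_in_imset (f := f)); last first.
  move=> b b' Bb Bb' /ffunP e; apply: det => // k kJ.
  by have := e k; rewrite !ffunE kJ.
apply: (@leq_trans #|pffun_on (0 : L) (mem J) (mem KL)|); last first.
  rewrite card_pffun_on; exact: leq_expr2.
apply/subset_leq_card/subsetP => _ /imsetP[b _ ->]; apply/pffun_onP; split.
  by apply/supportP => k /negPf kJ; rewrite ffunE kJ.
move=> _ /imageP[k kJ ->]; rewrite ffunE inE; move: kJ => /= -> /=.
by rewrite ft_fixed.
Qed.

Lemma ft_determined b b' : \sum_h b h = \sum_h b' h ->
  (forall k, ft b (t k) = ft b' (t k)) -> b = b'.
Proof.
move=> e0 e; apply: (@ft_inj _ _ iota _ _ chiM chi_eq1 nL chi1) => m.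
have [pm|/tP[k [f mE]]] := boolP (p %| m)%N.
  have m0 : (m = 0 %[mod p])%N by rewrite (eqP pm) mod0n.
  by rewrite !(ft_mod iota chiM chi1 _ m0) !ft_at0 e0.
by rewrite !(ft_mod iota chiM chi1 _ mE) !(ft_frobenius iota chi pcharq cardF) e.
Qed.

(** The trivial component, at m = 0, is left free; hence the factor q^2 in [card_ideal] and the
    extra 1 in the size of an information set. *)
Definition ideal J : {set FG} := [set a | [forall (k | k \notin J), ft a (t k) == 0]].

Lemma idealP J a : reflect (forall k, k \notin J -> ft a (t k) = 0) (a \in ideal J).
Proof.
rewrite inE; apply: (iffP forall_inP) => h k kJ; first exact/eqP/h.
exact/eqP/h.
Qed.

Lemma card_ideal J : (#|ideal J| <= q ^ 2 * K ^ #|J|)%N.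
Proof.
rewrite -sum1_card (partition_big (fun a : FG => \sum_h a h : F) predT) //=.
rewrite -cardF -sum_nat_const; apply: leq_sum => c _; rewrite sum1_card.
rewrite -cardsE; apply: card_determined => b b'.
rewrite !inE => /andP[/idealP Jb /eqP sb] /andP[/idealP Jb' /eqP sb'] e.
apply: ft_determined => [|k]; first by rewrite sb sb'.
by have [/e//|kJ] := boolP (k \in J); rewrite Jb ?Jb'.
Qed.

Let M := (64 * (64 * #|F|))%N.

Definition low J : {set FG} := [set a in ideal J | (M * #|supp a| <= p)%N].

(** An information set has d <= r |J| + 1 elements, so the count is at most 2 2^(d/16). Its square,
    which will count pairs (a, a b), meets the bound since 17 + r |J| <= 8 (r - 3) |J| for r > 5. *)
Lemma card_low J : J != set0 -> (#|low J| ^ 2 <= 2 ^ ((r - 3) * #|J|))%N.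
Proof.
rewrite -card_gt0 => J0.
have [||c a /idealP Ja|S Sinj cardS] := @information_set gT F (ideal J).
- by apply/idealP => k _; rewrite ft0.
- move=> a b /idealP Ja /idealP Jb; apply/idealP => k kJ.
  by rewrite ftD Ja ?Jb ?addr0.
- by apply/idealP => k kJ; rewrite ftZ Ja ?mulr0.
have dS : (#|S| <= r * #|J| + 1)%N.
  have := leq_trans cardS (card_ideal J).
  rewrite /K cardF -!expnM -expnD leq_exp2l //; lia.
have inj g : {in ideal J &, injective (fun v : {ffun gT -> F} =>
    [ffun h => if h \in S then v (g * h)%g else 0 : F])}.
  move=> a b /idealP Ja /idealP Jb /ffunP e.
  pose u : FG := [ffun h => (a - b : FG) (g * h)%g].
  have u0 : u = 0.
    apply: Sinj => [|h hS].
      apply/idealP => k kJ; rewrite (ft_translate iota chiM chi1).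
      by rewrite -scaleN1r ftD ftZ Ja ?Jb // mulr0 addr0 mulr0.
    by have := e h; rewrite !ffunE hS => ->; rewrite subrr.
  apply/ffunP => h; have /ffunP/(_ (g^-1 * h)%g) := u0.
  by rewrite !ffunE mulKVg => /eqP; rewrite subr_eq0 => /eqP.
have := low_weight_le M inj; have := @low_words_exp_le gT F S; rewrite -/M.
set W := #|low_words _ _ _|; rewrite -/(low J) => hW hl.
rewrite -(@leq_exp2r _ _ 8) // -!expnM.
apply: (@leq_trans ((2 * W) ^ 16)); first exact: leq_expr2.
rewrite expnMn; apply: (@leq_trans (2 ^ 16 * 2 ^ #|S|)); first by rewrite leq_mul.
rewrite -expnD leq_exp2l //.
have [r' rE] : exists r', r = (r' + 6)%N by exists (r - 6)%N; lia.
rewrite rE in dS *; nia.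
Qed.

Definition augmentation_ideal : {set FG} := [set b : FG | \sum_h b h == 0].
Local Notation A := augmentation_ideal.

(** Sending b to its augmentation and its projection to A is injective, so q^2 |A| >= |FG| = q^2
    K^s, by s r = p - 1. *)
Lemma card_augmentation_ideal : (K ^ s <= #|A|)%N.
Proof.
have q2 : (0 < q ^ 2)%N by rewrite expn_gt0; lia.
rewrite -(leq_pmul2l q2).
have -> : (q ^ 2 * K ^ s = #|{: FG}|)%N.
  rewrite card_ffun cardF /K -expnM mulnC -expnSr; congr (_ ^ _)%N.
  by rewrite mulnC sr prednK // prime_gt0.
pose d c : FG := [ffun h => if h == 1%g then c else 0].
have dE c : \sum_h d c h = c.
  rewrite (bigD1 1%g) //= big1 ?addr0 ?ffunE ?eqxx // => h /negPf h1.
  by rewrite ffunE h1.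
pose f (b : FG) : F * FG := (\sum_h b h, b - d (\sum_h b h)).
have finj : injective f.
  by move=> b b' [->] /addIr.
rewrite -cardF -(card_imset _ finj) -[#|F|]cardsT -cardsX.
apply/subset_leq_card/subsetP => _ /imsetP[b _ ->]; rewrite !inE /=.
by under eq_bigr => h _ do rewrite ffunE ffunE; rewrite sumrB dE subrr.
Qed.

Section LCD.
Variable w : nat.
Hypothesis qw : (p %| q * w + 1)%N.

(** Since w = - 1 / q modulo p, [ft_herm_inv] makes the expression the coefficient of 1 + b tau(b)
    at m. *)
Definition not_lcd m : {set FG} :=
  [set b in A | 1 + ft b m * ft b (w * m) ^+ q == 0].

(* [m] and [- m / q] lie in different orbits, because [-1] is not a power of
   [q] modulo [p]; so the component of [b] at [m] is determined by the others. *)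
Lemma card_not_lcd m : ~~ (p %| m)%N -> (#|not_lcd m| <= K ^ s.-1)%N.
Proof.
move=> pm; have [k [e mE]] := tP pm.
have cwm : ~~ (p %| w * m)%N.
  rewrite Euclid_dvdM // negb_or pm andbT; apply: contraTN qw => pw.
  by rewrite dvdn_addr ?dvdn_mull // Euclid_dvd1.
have [k' [e' wmE]] := tP cwm.
have FpE (x y : nat) : (x = y %[mod p])%N -> x%:R = y%:R :> 'F_p.
  by move=> xy; apply/eqP; rewrite -val_eqE /= !val_Fp_nat // xy.
have Fp0 x : (x%:R == 0 :> 'F_p) = (p %| x)%N.
  by rewrite -val_eqE /= val_Fp_nat.
have k'k : k' != k.
  apply/eqP => kk; rewrite kk in wmE.
  have tk0 : (t k)%:R != 0 :> 'F_p.
    rewrite Fp0; apply: contra pm => ptk.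
    by rewrite /dvdn mE -/(dvdn _ _) dvdn_mulr.
  have qX j : (q ^ j)%:R ^+ r = 1 :> 'F_p.
    rewrite -natrX -expnM; apply: (FpE _ 1%N); apply/ordq; exact: dvdn_mull.
  have : (q ^ (2 * e').+1)%:R + (q ^ (2 * e))%:R == 0 :> 'F_p.
    have : (q * (w * m) + m)%:R == 0 :> 'F_p.
      by rewrite Fp0 mulnA -[X in (_ + X)%N]mul1n -mulnDl dvdn_mulr.
    rewrite natrD natrM (FpE _ _ wmE) (FpE _ _ mE) !natrM -!expnM expnS natrM.
    by rewrite mulrCA -mulrDr mulf_eq0 (negPf tk0).
  (* Taking r-th powers gives 1 = (-1)^r = -1 as r is odd, against p > 2. *)
  rewrite addr_eq0 => /eqP/(congr1 (fun x => x ^+ r)).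
  rewrite exprNn !qX mulr1 -signr_odd r_odd expr1 => /eqP.
  rewrite -addr_eq0 (Fp0 2%N) => /dvdn_leq; lia.
have -> : (s.-1 = #|~: [set k]|)%N by rewrite cardsC1 card_ord.
apply: card_determined => b b'.
rewrite !inE => /andP[/eqP sb /eqP hb] /andP[/eqP sb' /eqP hb'] eD.
have ek' : ft b (w * m) = ft b' (w * m).
  by rewrite !(ft_mod iota chiM chi1 _ wmE) !(ft_frobenius iota chi pcharq cardF) eD ?inE.
(* The coefficient at w m is known and nonzero, so the equation of [not_lcd] yields the one at m. *)
have em : ft b m = ft b' m.
  have u0 : ft b (w * m) ^+ q != 0.
    apply/eqP => u0; move/eqP: hb; rewrite u0 mulr0 addr0 oner_eq0 //.
  apply: (mulIf u0); apply: (addrI 1); rewrite hb ek'; exact/esym.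
apply: ft_determined => [|j]; first by rewrite sb sb'.
have [->|jk] := eqVneq j k; last by apply: eD; rewrite !inE.
have tkE : (t k = m * (q ^ 2) ^ (e * r.-1) %[mod p])%N.
  rewrite -modnMml mE modnMml -mulnA -expnD -mulnS prednK // (mulnC e).
  by rewrite -modnMmr q2X_mod modnMmr muln1.
by rewrite !(ft_mod iota chiM chi1 _ tkE) !(ft_frobenius iota chi pcharq cardF) em.
Qed.

Definition not_distant J : {set FG} :=
  [set b in A | [exists a in low J,
     (J == [set k | ft a (t k) != 0]) && (galg_mul a b \in low J)]].

(** For fixed a and a' = a b, the coefficients of b on J are quotients of those of a' and a; only
    those outside J remain free. *)
Lemma card_not_distant J : (#|not_distant J| <= #|low J| ^ 2 * K ^ (s - #|J|))%N.
Proof.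
pose sol (aa : FG * FG) := [set b in A | (J == [set k | ft aa.1 (t k) != 0])
  && (galg_mul aa.1 b == aa.2)].
have cardJ : #|~: J| = (s - #|J|)%N by rewrite cardsCs setCK card_ord.
have sub : not_distant J \subset \bigcup_(aa in setX (low J) (low J)) sol aa.
  apply/subsetP => b; rewrite inE => /andP[bA /exists_inP[a la /andP[Ja lb]]].
  apply/bigcupP; exists (a, galg_mul a b); first by rewrite inE la.
  by rewrite inE bA Ja eqxx.
apply: leq_trans (subset_leq_card sub) _.
apply: leq_trans (card_bigcup_le _ _) _.
apply: (@leq_trans (\sum_(aa in setX (low J) (low J)) K ^ (s - #|J|)))%N; last first.
  by rewrite sum_nat_const cardsX mulnn.
apply: leq_sum => -[a a'] _; rewrite -cardJ; apply: card_determined => b b'.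
rewrite [b \in _]inE [b' \in _]inE /= => /andP[bA /andP[/eqP Ja /eqP ab]].
move=> /andP[b'A /andP[_ /eqP ab']] e.
move: bA b'A; rewrite !inE => /eqP sb /eqP sb'.
apply: ft_determined => [|k]; first by rewrite sb sb'.
have [kJ|kJ] := boolP (k \in J); last by apply: e; rewrite inE.
rewrite Ja inE in kJ; apply: (mulfI kJ).
by rewrite -!(ft_galg_mul iota chiM) ab ab'.
Qed.

(** This follows from 4 p <= 2^r q^r <= K. Here and in the next lemma, the 4 keeps each kind of bad
    b within a quarter of A. *)
Lemma sum_card_not_lcd : (4 * \sum_(m < p | m != 0 :> nat) #|not_lcd m| <= K ^ s)%N.
Proof.
have s0 : (0 < s)%N by case: (s) sr => // /esym/eqP; lia.
have -> : (K ^ s = K * K ^ s.-1)%N by rewrite -expnS prednK.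
have h : (\sum_(m < p | m != 0 :> nat) #|not_lcd m| <= p * K ^ s.-1)%N.
  apply: (@leq_trans (\sum_(m < p) K ^ s.-1))%N; last by rewrite sum_nat_const card_ord.
  rewrite big_mkcond; apply: leq_sum => m _; case: ifP => // m0.
  by apply: card_not_lcd; rewrite gtnNdvd // lt0n.
apply: (@leq_trans (4 * (p * K ^ s.-1)))%N; first by rewrite leq_mul2l h orbT.
rewrite mulnA leq_mul2r; apply/orP; right.
rewrite /K -expnM (mulnC 2%N) expnM -mulnn; apply: leq_mul; last exact: ltnW.
apply: (@leq_trans (2 ^ r)); last exact: leq_expr2.
by rewrite (@leq_exp2l 2 2) //; lia.
Qed.

(** The term of J is at most K^s y^|J|, and the sum of y^|J| over all J is (1 + y)^s <= 1 + 2 s y,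
    where the 1 accounts for the excluded empty J. Finally 8 s y = s 2^r / K <= 1, because s <
    q^r. *)
Lemma sum_card_not_distant :
  (4 * \sum_(J : {set 'I_s} | J != set0) #|not_distant J| <= K ^ s)%N.
Proof.
pose y : rat := (2 ^ (r - 3))%:R / K%:R.
have K0 : 0 < K%:R :> rat by rewrite ltr0n.
have y0 : 0 <= y by rewrite divr_ge0 ?ler0n.
have sy : 8 * s%:R * y <= 1.
  rewrite /y mulrA ler_pdivrMr // mul1r -!natrM ler_nat.
  rewrite mulnAC (_ : 8 = 2 ^ 3)%N // -expnD subnKC; last lia.
  rewrite /K -expnM (mulnC 2%N) expnM -mulnn; apply: leq_mul; first exact: leq_expr2.
  apply: leq_trans (ltnW p_lt).
  apply: (@leq_trans (s * r)%N); first by rewrite leq_pmulr.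
  by rewrite sr leq_pred.
have sumJ : \sum_(J : {set 'I_s}) y ^+ #|J| <= 1 + 2 * s%:R * y.
  apply: (le_trans _ (@expr1D_le _ y s y0 _)); last first.
    have : 0 <= s%:R :> rat by []. nra.
  rewrite -[s in X in _ <= X]card_ord -prodr_const.
  under [leRHS]eq_bigr => i _ do rewrite addrC.
  rewrite bigA_distr; apply: ler_sum => J _.
  rewrite -big_mkcond /= prodr_const //.
rewrite -(ler_nat rat) natrM natr_sum (natrX _ K s).
apply: (@le_trans _ _ (4 * \sum_(J : {set 'I_s} | J != set0) K%:R ^+ s * y ^+ #|J|)).
  rewrite ler_pM2l //; apply: ler_sum => J J0.
  apply: (@le_trans _ _ (2 ^ ((r - 3) * #|J|) * K ^ (s - #|J|))%:R).
    rewrite ler_nat; apply: leq_trans (card_not_distant J) _.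
    by rewrite leq_mul2r card_low ?orbT.
  have Js : (#|J| <= s)%N by rewrite -[leqRHS]card_ord max_card.
  have alg (k c j : nat) : (0 < k)%N -> (j <= s)%N ->
      (c ^ j * k ^ (s - j))%:R = k%:R ^+ s * (c%:R / k%:R) ^+ j :> rat.
    move=> k0 js; rewrite natrM !natrX exprMn exprVn -[in RHS](subnK js) exprD.
    by rewrite mulrACA mulfV ?mulr1 1?mulrC // expf_neq0 // pnatr_eq0 -lt0n.
  by rewrite expnM alg.
rewrite -big_distrr /=; move: sumJ; rewrite (bigD1 set0) //= cards0 expr0.
have : 0 <= K%:R ^+ s :> rat by rewrite exprn_ge0 // ltW.
move: (\sum_(_ | _) _) (K%:R ^+ s) => A B; nra.
Qed.

Lemma good_multiplier : exists b, [/\ b \in A,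
  forall m, ~~ (p %| m)%N -> 1 + ft b m * ft b (w * m) ^+ q != 0
  & forall J, J != set0 -> b \notin not_distant J].
Proof.
pose bad := \bigcup_(m : 'I_p | m != 0 :> nat) not_lcd m
  :|: \bigcup_(J : {set 'I_s} | J != set0) not_distant J.
have : ~~ (A \subset bad).
  apply/negP => /subset_leq_card; apply/negP; rewrite -ltnNge.
  apply: leq_trans card_augmentation_ideal.
  have Ks : (0 < K ^ s)%N by rewrite expn_gt0 K_gt0.
  have := sum_card_not_lcd; have := sum_card_not_distant.
  have := @card_bigcup_le _ _ (fun m : 'I_p => m != 0 :> nat) not_lcd.
  have := @card_bigcup_le _ _ (fun J : {set 'I_s} => J != set0) not_distant.
  have : (#|bad| <= #|\bigcup_(m : 'I_p | m != 0 :> nat) not_lcd m|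
     + #|\bigcup_(J : {set 'I_s} | J != set0) not_distant J|)%N.
    by rewrite cardsU leq_subr.
  move: #|bad| #|\bigcup_(m | _) _| #|\bigcup_(J | _) _| Ks.
  move: (\sum_(_ | _) _)%N (\sum_(_ | _) _)%N (K ^ s)%N => x1 x2 x3 x4 x5 x6.
  clear; lia.
case/subsetPn => b bA; rewrite inE negb_or => /andP[/bigcupP h1 /bigcupP h2].
exists b; split=> // [m pm|J J0]; last by apply/negP => bJ; apply: h2; exists J.
have p0 := prime_gt0 pr_p.
have e1 : (m = m %% p %[mod p])%N by rewrite modn_mod.
have e2 : (w * m = w * (m %% p) %[mod p])%N by rewrite modnMmr.
rewrite (ft_mod iota chiM chi1 _ e1) (ft_mod iota chiM chi1 _ e2).
apply/negP => h; apply: h1; exists (Ordinal (ltn_pmod m p0)) => //.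
by rewrite inE bA.
Qed.

End LCD.
Lemma exists_lcd_code : exists C : {vspace galg2 F gT},
  [/\ is_FG_submodule C, herm_LCD q C, \dim C = p
    & forall c, c \in C -> c != 0 -> (p < M * wtH c)%N].
Proof.
have p0 := prime_gt0 pr_p.
(* Modulo p, q^(r - 1) inverts q and p - 1 is -1. *)
pose w := (q ^ r.-1 * p.-1)%N.
have qw : (p %| q * w + 1)%N.
  rewrite /w mulnA -expnS prednK // /dvdn -modnDml -modnMml.
  have -> : (q ^ r = 1 %[mod p])%N by apply/ordq.
  by rewrite modnMml modnDml mul1n addn1 prednK // modnn.
have [b [bA blcd bdist]] := good_multiplier qw.
have b0 : ft b 0 = 0.
  by move: bA; rewrite inE => /eqP e; rewrite ft_at0 e rmorph0.
exists (multiplier_code b); split.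
- exact: multiplier_code_submodule.
- move=> _ /multiplier_codeP[a ->] /herm_orthogonal_multiplier_code e.
  suff -> : a = 0 by apply: raddf0.
  apply: (@herm_inv_eq0 _ _ q); apply: (@ft_inj _ _ iota _ _ chiM chi_eq1 nL chi1).
  move=> m; rewrite ft0.
  have dv : (p %| q * (w * m) + m)%N.
    by rewrite mulnA -[X in (_ + X)%N]mul1n -mulnDl dvdn_mulr.
  have := ft0 iota chi m; rewrite -e ftD (ft_galg_mul iota chiM).
  rewrite !(ft_herm_inv iota chiM chi1 pcharq _ dv) (ft_galg_mul iota chiM).
  rewrite exprMn mulrCA -{1}[ft a _ ^+ q]mulr1 -mulrDr => /eqP; rewrite mulf_eq0.
  (* When p divides m the second factor is 1, because b lies in the augmentation ideal. *)
  case/orP=> [/eqP //|/eqP h]; have [pm|/blcd] := boolP (p %| m)%N;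
    last by rewrite h eqxx.
  have m0 : (m = 0 %[mod p])%N by rewrite (eqP pm) mod0n.
  move/eqP: h; rewrite (ft_mod iota chiM chi1 _ m0) b0 mul0r addr0 oner_eq0 //.
- exact: dim_multiplier_code.
move=> _ /multiplier_codeP[a ->] nz; rewrite ltnNge; apply/negP => lw.
have a0 : a != 0 by apply: contraNneq nz => ->; rewrite raddf0.
have M1 : (1 < M)%N.
  by rewrite /M mulnA; apply: leq_trans (leq_pmulr _ (ltnW (finNzRing_gt1 F))).
have lwa : (M * #|supp a| <= p)%N.
  by apply: leq_trans lw; rewrite leq_mul2l /wtH leq_addr orbT.
have lwab : (M * #|supp (galg_mul a b)| <= p)%N.
  by apply: leq_trans lw; rewrite leq_mul2l /wtH leq_addl orbT.
pose J := [set k | ft a (t k) != 0].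
have Ja : a \in ideal J by apply/idealP => k; rewrite inE negbK => /eqP.
(* If only the trivial component of a can be nonzero, a is a nonzero constant of full weight p, too
   heavy since M > 1. *)
have [J0|J0] := eqVneq J set0.
  have tk0 k : ft a (t k) = 0 by apply: (idealP _ _ Ja); rewrite J0 inE.
  have acst : forall g h, a g = a h.
    apply: (ft_supp_at0 chiM chi_eq1 nL chi1 (iota := iota)) => m /tP[k [e mE]].
    rewrite (ft_mod iota chiM chi1 _ mE) (ft_frobenius iota chi pcharq cardF) tk0.
    by rewrite expr0n expn_eq0 expn_eq0; case: (q) q_gt1.
  have : #|supp a| = p.
    rewrite -[RHS]cardsT; apply: eq_card => g; rewrite !inE.
    apply: contraNneq a0 => ag; apply/eqP/ffunP => h; rewrite ffunE -ag; exact: acst.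
  by move=> e; move: lwa; rewrite e leqNgt ltn_Pmull.
have := bdist J J0; rewrite inE bA /= => /negP; apply; apply/exists_inP; exists a.
  by rewrite inE Ja.
rewrite eqxx /= inE lwab andbT; apply/idealP => k kJ.
by rewrite (ft_galg_mul iota chiM) (idealP _ _ Ja) ?mul0r.
Qed.

End RandomCode.

(** * Choice of the lengths and conclusion *)

Theorem theorem3p17 (q : nat)
  (hq : exists p k : nat, [/\ prime p, (0 < k)%N & q = (p ^ k)%N])
  (F : finFieldType) (hF : #|F| = (q ^ 2)%N) :
  exists n : nat -> nat,
    (forall i, [/\ (0 < n i)%N, odd (n i) & coprime (n i) q]) /\
    (forall i, (n i < n i.+1)%N) /\
    forall G : nat -> finGroupType,
      (forall i, abelian [set: G i] /\ #|G i| = n i) ->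
      exists2 delta : rat, 0 < delta &
        forall i, exists C : {vspace galg2 F (G i)},
          [/\ is_FG_submodule C, herm_LCD q C,
              (\dim C)%:R / (2 * n i)%:R = (1 / 2 : rat)
            & rel_min_dist_gt C delta].
Proof.
have [l [k [pr_l k0 qE]]] := hq.
have q1 : (1 < q)%N by rewrite qE -(exp1n k) ltn_exp2r // prime_gt1.
pose good (p : nat) := exists r, [/\ prime p, odd r, (5 < r)%N, (r < p < q ^ r)%N
  & forall e, (q ^ e = 1 %[mod p] <-> r %| e)%N].
(* The bound 5 ensures r > 5, so r is odd; p > r > N makes the iterates of [f] increase. *)
pose f N := projT1 (prime_of_large_order (maxn N 5) q1).
have fP N : (N < f N)%N /\ good (f N).
  rewrite /f; case: prime_of_large_order => p [r [pr_p pr_r Nr rp ordq]] /=.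
  have [N_r r5] : (N < r)%N /\ (5 < r)%N by lia.
  split; first by case/andP: rp => /(ltn_trans N_r).
  by exists r; split=> //; case: (even_prime pr_r) => // rE; lia.
pose n i := iter i.+1 f 0%N.
exists n; have ngood i : good (n i) by have [] := fP (iter i f 0%N).
(* Otherwise q would vanish modulo [n i], while q^r = 1 there. *)
have n_l i : l != n i.
  have [r [pr_p _ r5 /andP[rp _] ordq]] := ngood i; apply/eqP => lE.
  have /eqP := (ordq r).2 (dvdnn r).
  have dv : (l %| l ^ (k * r))%N by rewrite dvdn_exp // muln_gt0 k0; lia.
  by rewrite -lE qE -expnM (eqP dv) modn_small // prime_gt1.
split; last split.
- move=> i; have [r [pr_p r_odd r5 /andP[rp _] ordq]] := ngood i.
  split; [exact: prime_gt0 | | ].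
    by case: (even_prime pr_p) => // pE; lia.
  by rewrite prime_coprime // qE Euclid_dvdX // k0 andbT dvdn_prime2 // eq_sym n_l.
- by move=> i; have [] := fP (n i).
move=> G GP.
have F0 : (0 < #|F|)%N by rewrite hF expn_gt0; lia.
pose M := (64 * (64 * #|F|))%N; have M0 : (0 < M)%N by rewrite !muln_gt0 F0.
(* Weights above p / M in length 2 p; M depends only on F. *)
exists (1 / (2 * M)%:R); first by rewrite divr_gt0 // ltr0n muln_gt0.
move=> i; have [_ Gi] := GP i.
have [r [pr_p r_odd r5 /andP[rp pq] ordq]] := ngood i.
have lF : l \in [pchar F].
  by apply: (@card_finPcharP _ l (k * 2)) => //; rewrite hF qE expnM.
have pF : (n i)%:R != 0 :> F.
  by rewrite -(dvdn_pcharf lF) dvdn_prime2.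
have [L [iota [z zn]]] := prim_root_extension pr_p pF.
(* As r is odd, q^2 has the same order as q. *)
have ordQ e : ((q ^ 2) ^ e = 1 %[mod n i] <-> r %| e)%N.
  rewrite -expnM; split=> [/ordq|re]; last by apply/ordq; rewrite dvdn_mull.
  rewrite Gauss_dvdr // coprime_sym coprime2n //.
have [s [t [sr tP]]] := orbit_representatives pr_p ordQ (ltn_trans (ltn0Sn 4) r5).
rewrite -Gi in pr_p rp pq ordq pF zn sr tP *.
have [chi [chi1 chiM chi_eq1]] := faithful_character pr_p zn.
have nL : #|G i|%:R != 0 :> L by rewrite -(rmorph_nat iota) fmorph_eq0.
have qL : [pchar L].-nat q.
  rewrite qE pnatX; apply/orP; left; rewrite pnatE //.
  by rewrite (fmorph_pchar iota).
have p2 : (2 < #|G i|)%N by apply: ltn_trans rp; apply: ltn_trans r5.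
have [C [C1 C2 C3 C4]] := exists_lcd_code iota chiM chi_eq1 nL chi1 qL hF q1 pr_p
  p2 pq r5 r_odd ordq sr tP.
exists C; split=> //.
  rewrite C3 natrM -[X in X / _ = _]mul1r -mulf_div divff ?mulr1 //.
  by rewrite pnatr_eq0 -lt0n prime_gt0.
move=> c Cc c0; have := C4 c Cc c0; rewrite -/M => lt.
have n0 : 0 < #|G i|%:R :> rat by rewrite ltr0n prime_gt0.
rewrite ltr_pdivrMr ?ltr0n ?muln_gt0 // mulrAC ltr_pdivlMr; last first.
  by rewrite ltr0n muln_gt0 (prime_gt0 pr_p).
by rewrite mul1r -natrM ltr_nat mulnCA ltn_pmul2l // mulnC.
Qed.
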